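(* Let $C^\infty(\mathbb{R})$ be the space of infinitely differentiable real-valued functions on $\mathbb{R}$, with the topology defined by the collection $\|x\|_k=\max_{j\le k}\max_{t\in[-k,k]}|x^{(j)}(t)|$, $k=0,1,2,\dots$, and let $Y$ be a real linear topological space. Then every bounded-differentiable germ at $0\in C^\infty(\mathbb{R})$ into $Y$ has a global bounded-differentiable representative, and every compact-differentiable germ at $0\in C^\infty(\mathbb{R})$ into $Y$ has a global compact-differentiable representative.
   Context: Differentiability. A map $f$ from a neighborhood of $x$ in a linear topological space $X$ to a linear topological space $Y$ is differentiable at $x$ if there is a continuous linear $A:X\to Y$ such that, with $r(h)=f(x+h)-f(x)-Ah$: (i) bounded differentiability: for every bounded set $S\subset X$ (bounded in the sense of linear topological spaces), $r(th)/t\to 0$ as $t\to 0$ ($t\in\mathbb{R}$), uniformly in $h\in S$; (ii) compact (Hadamard) differentiability: $f(x+t_nh_n)-f(x)=t_nAh+o(t_n)$ whenever $t_n\to 0$ in $\mathbb{R}$ and $h_n\to h$ in $X$. A map is differentiable on a set if it is differentiable at every point of it. Germs. A germ at $0\in X$ into $Y$ is an equivalence class of maps into $Y$ defined on neighborhoods of $0$, any two of which coincide on some neighborhood of $0$; its elements are called representatives. A germ is differentiable (in a given sense) if it has a representative differentiable in that sense on a neighborhood of $0$. A global differentiable representative is a representative defined and differentiable (in that sense) on all of $X$. *)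

(* Defs.v *)
From HB Require Import structures.
From mathcomp Require Import all_boot all_order all_algebra.
From mathcomp Require Import all_classical all_reals all_analysis.

Set Implicit Arguments.
Unset Strict Implicit.
Unset Printing Implicit Defensive.

Import Order.TTheory GRing.Theory Num.Theory.
Import numFieldTopology.Exports numFieldNormedType.Exports.

Local Open Scope classical_set_scope.
Local Open Scope ring_scope.

Section Differentiability.
Context {R : realType} {X Y : topologicalLmodType R}.

(* A partial map is a domain together with a total function; the values of
   that function outside the domain are irrelevant. *)
Record pmap := PMap { dom : set X; pfun :> X -> Y }.

Definition tvs_bounded (S : set X) : Prop :=
  forall U : set X, nbhs (0 : X) U ->
    \forall r \near +oo%R, S `<=` [set (r : R) *: u | u in U].

(* [x + t *: h] lies in [dom f] for all small [t], uniformly for [h] in a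
   bounded set, because [dom f] is a neighborhood of [x]. *)
Definition bounded_differentiable_at (f : pmap) (x : X) : Prop :=
  nbhs x (dom f) /\
  exists A : {linear X -> Y}, continuous A /\
    let r h := f (x + h) - f x - A h in
    forall S : set X, tvs_bounded S ->
    forall W : set Y, nbhs (0 : Y) W ->
      \forall t \near (0 : R)^', forall h, S h -> W (t^-1 *: r (t *: h)).

(* The remainder [f (x + t_n h_n) - f x - t_n A h] vanishes when [t_n = 0],
   and then so does the quotient, since [0^-1 = 0]; hence convergence of the
   quotients to 0 says exactly that the remainder is [o(t_n)]. *)
Definition compact_differentiable_at (f : pmap) (x : X) : Prop :=
  nbhs x (dom f) /\
  exists A : {linear X -> Y}, continuous A /\
    forall (t : nat -> R) (h_ : nat -> X) (h : X),
      t n @[n --> \oo] --> (0 : R) -> h_ n @[n --> \oo] --> h ->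
      (t n)^-1 *: (f (x + t n *: h_ n) - f x - t n *: A h) @[n --> \oo]
        --> (0 : Y).

Definition germ_equiv (f g : pmap) : Prop :=
  exists2 U : set X, nbhs (0 : X) U &
    U `<=` dom f `&` dom g /\ forall x, U x -> f x = g x.

Record germ := Germ {
  representative :> set pmap;
  germ_class : exists2 f : pmap, nbhs (0 : X) (dom f) &
    representative = [set g | nbhs (0 : X) (dom g) /\ germ_equiv f g]
}.

Section GermDifferentiability.
Variable diff_at : pmap -> X -> Prop.

Definition differentiable_germ (G : germ) : Prop :=
  exists2 f : pmap, representative G f &
    exists2 U : set X, nbhs (0 : X) U & forall x, U x -> diff_at f x.

Definition has_global_representative (G : germ) : Prop :=
  exists2 f : pmap, representative G f &
    dom f = setT /\ forall x, diff_at f x.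

End GermDifferentiability.

End Differentiability.

Arguments pmap {R} X Y.
Arguments germ {R} X Y.

Section SmoothFunctions.
Variable R : realType.

Definition smooth : {pred R -> R^o} :=
  mem [set f : R -> R^o | forall n t, derivable (derive1n n f) t 1].

Lemma smoothP (f : R -> R^o) :
  f \in smooth <-> forall n t, derivable (derive1n n f) t 1.
Proof. by split => [/set_mem|fn]; [|apply/mem_set]. Qed.

Lemma derive1n_lin (a : R) (f g : R -> R^o) n :
  (forall n t, derivable (derive1n n f) t 1) ->
  (forall n t, derivable (derive1n n g) t 1) ->
  derive1n n (a *: f + g) = a *: derive1n n f + derive1n n g.
Proof.
move=> sf sg; elim: n => // n IH; rewrite !derive1nS IH; apply/funext => t.
rewrite derive1E deriveD//; last exact: (derivableZ (sf n t)).
by rewrite (deriveZ _ (sf n t)) -!derive1E.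
Qed.

Lemma derive1n_0 n : derive1n n (0 : R -> R^o) = 0.
Proof.
by elim: n => // n IH; rewrite derive1nS IH; apply/funext => t; rewrite derive1_cst.
Qed.

Lemma smooth_submod_closed : submod_closed smooth.
Proof.
split=> [|a f g /smoothP sf /smoothP sg]; apply/smoothP => n t.
  by rewrite derive1n_0; exact: derivable_cst.
rewrite derive1n_lin//; apply: derivableD => //; exact: (derivableZ (sf n t)).
Qed.

HB.instance Definition _ :=
  GRing.isSubmodClosed.Build R (R -> R^o) smooth smooth_submod_closed.

End SmoothFunctions.

Record Cinf (R : realType) :=
  MkCinf { Cinf_fun :> R -> R^o; _ : Cinf_fun \in @smooth R }.

Section CinfTopology.
Variable R : realType.

HB.instance Definition _ := [isSub for @Cinf_fun R].
HB.instance Definition _ := [Choice of Cinf R by <:].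
HB.instance Definition _ := [SubChoice_isSubLmodule of Cinf R by <:].

Implicit Types (x y : Cinf R) (k : nat).

(* By compactness the [sup] is attained, hence is a maximum. *)
Definition Cinf_norm k x : R :=
  \big[Num.max/0]_(j < k.+1)
    sup [set `|derive1n j x t| | t in `[- k%:R, k%:R]].

Lemma CinfP x n t : derivable (derive1n n x) t 1.
Proof. by move: n t; apply/smoothP; case: x. Qed.

Lemma derive1n_Cinf_lin (a : R) x y n t :
  derive1n n (a *: x + y) t = a * derive1n n x t + derive1n n y t.
Proof. by rewrite /= derive1n_lin//; exact: CinfP. Qed.

Lemma Cinf_norm_bounded k j x :
  has_sup [set `|derive1n j x t| | t in `[- k%:R, k%:R]].
Proof.
have k0 : (- k%:R : R) <= k%:R by rewrite (le_trans _ (ler0n _ k))// oppr_le0.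
split; first by exists `|derive1n j x k%:R|, k%:R => //=; rewrite in_itv/= k0 lexx.
have cf : continuous (fun t => `|derive1n j x t| : R).
  move=> t; apply: (@continuous_comp _ _ _ (derive1n j x) (fun z => `|z|)).
    by apply: differentiable_continuous; apply/derivable1_diffP; exact: CinfP.
  exact: norm_continuous.
have [c _ cmax] := EVT_max k0 (continuous_subspaceT cf).
by exists `|derive1n j x c| => _ [t tk <-]; exact: cmax.
Qed.

Lemma Cinf_norm_le k x (c : R) : Cinf_norm k x <= c <->
  0 <= c /\ forall j t, (j <= k)%N -> `|t| <= k%:R -> `|derive1n j x t| <= c.
Proof.
split=> [xc|[c0 xc]].
  split=> [|j t jk tk]; first by apply: le_trans xc; exact: bigmax_ge_id.
  apply: le_trans xc; pose i : 'I_k.+1 := Ordinal (jk : (j < k.+1)%N).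
  apply: le_trans (le_bigmax_cond _ _ (isT : xpredT i)).
  apply: (ub_le_sup (proj2 (Cinf_norm_bounded k j x))).
  by exists t => //=; rewrite in_itv/= -ler_norml.
apply: bigmax_le => // j _; apply: ge_sup; first by case: (Cinf_norm_bounded k j x).
move=> _ [t tk <-]; apply: xc; first by rewrite -ltnS.
by move: tk; rewrite /= in_itv/= -ler_norml.
Qed.

Lemma Cinf_norm_ge0 k x : 0 <= Cinf_norm k x.
Proof. by have /Cinf_norm_le[] := lexx (Cinf_norm k x). Qed.

Lemma Cinf_norm_ge k x j t : (j <= k)%N -> `|t| <= k%:R ->
  `|derive1n j x t| <= Cinf_norm k x.
Proof. by have /Cinf_norm_le[_] := lexx (Cinf_norm k x); apply. Qed.

Lemma Cinf_norm_lin k (a : R) x y :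
  Cinf_norm k (a *: x + y) <= `|a| * Cinf_norm k x + Cinf_norm k y.
Proof.
apply/Cinf_norm_le; split=> [|j t jk tk].
  by rewrite addr_ge0 ?mulr_ge0 ?Cinf_norm_ge0.
rewrite derive1n_Cinf_lin (le_trans (ler_normD _ _))// normrM.
by rewrite lerD ?ler_wpM2l ?Cinf_norm_ge.
Qed.

Lemma Cinf_normD k x y : Cinf_norm k (x + y) <= Cinf_norm k x + Cinf_norm k y.
Proof. by have := Cinf_norm_lin k 1 x y; rewrite scale1r normr1 mul1r. Qed.

Lemma Cinf_norm0 k : Cinf_norm k 0 = 0.
Proof.
apply/le_anti; rewrite Cinf_norm_ge0 andbT; apply/Cinf_norm_le.
by split=> // j t _ _; rewrite /= derive1n_0 normr0.
Qed.

Lemma Cinf_normZ k (a : R) x : Cinf_norm k (a *: x) <= `|a| * Cinf_norm k x.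
Proof. by have := Cinf_norm_lin k a x 0; rewrite !addr0 Cinf_norm0 addr0. Qed.

Lemma Cinf_norm_mono k l x : (k <= l)%N -> Cinf_norm k x <= Cinf_norm l x.
Proof.
move=> kl; apply/Cinf_norm_le; split=> [|j t jk tk]; first exact: Cinf_norm_ge0.
by apply: Cinf_norm_ge; rewrite ?(leq_trans jk)// (le_trans tk)// ler_nat.
Qed.

(* [Cinf_norm k x] is nondecreasing in [k] (Cinf_norm_mono), so the balls of
   the single seminorms already form a neighborhood base of the topology
   defined by the whole family. *)
Definition Cinf_nbhs x (A : set (Cinf R)) : Prop :=
  exists k, exists2 e : R, 0 < e & [set y | Cinf_norm k (y - x) < e] `<=` A.

HB.instance Definition _ := hasNbhs.Build (Cinf R) Cinf_nbhs.

Let Cinf_nbhs_filter x : ProperFilter (nbhs x).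
Proof.
apply: Build_ProperFilter_ex.
  move=> A [k [e e0 eA]]; exists x; apply: eA => /=.
  by rewrite subrr Cinf_norm0.
split.
- by exists 0%N, 1.
- move=> A B [k [e e0 eA]] [l [d d0 dB]].
  exists (maxn k l), (Num.min e d); first by rewrite lt_min e0.
  move=> y /=; rewrite lt_min => /andP[ye yd]; split.
    by apply: eA; apply: le_lt_trans ye; rewrite Cinf_norm_mono// leq_maxl.
  by apply: dB; apply: le_lt_trans yd; rewrite Cinf_norm_mono// leq_maxr.
- by move=> A B AB [k [e e0 eA]]; exists k, e => // y /eA /AB.
Qed.

Let Cinf_nbhs_singleton x (A : set (Cinf R)) : nbhs x A -> A x.
Proof. by move=> [k [e e0 eA]]; apply: eA => /=; rewrite subrr Cinf_norm0. Qed.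

Let Cinf_nbhs_nbhs x (A : set (Cinf R)) : nbhs x A -> nbhs x (nbhs^~ A).
Proof.
move=> [k [e e0 eA]]; exists k, e => // y /= yx.
exists k, (e - Cinf_norm k (y - x)); first by rewrite subr_gt0.
move=> z /=; rewrite ltrBrDr => zy; apply: eA => /=; apply: le_lt_trans zy.
by rewrite -[z in leLHS](subrK y) -addrA Cinf_normD.
Qed.

HB.instance Definition _ := Nbhs_isNbhsTopological.Build (Cinf R)
  Cinf_nbhs_filter Cinf_nbhs_singleton Cinf_nbhs_nbhs.

Lemma Cinf_add_continuous : continuous (fun z : Cinf R * Cinf R => z.1 + z.2).
Proof.
move=> [x y] A [k [e e0 eA]].
exists ([set u | Cinf_norm k (u - x) < e / 2],
        [set v | Cinf_norm k (v - y) < e / 2]).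
  by split; exists k, (e / 2); rewrite ?divr_gt0.
move=> [u v] /= [ux vy]; apply: eA => /=; rewrite opprD addrACA.
by rewrite (le_lt_trans (Cinf_normD _ _ _))// [e]splitr ltrD.
Qed.

HB.instance Definition _ :=
  PreTopologicalNmodule_isTopologicalNmodule.Build (Cinf R) Cinf_add_continuous.

Lemma Cinf_scale_continuous : continuous (fun z : R^o * Cinf R => z.1 *: z.2).
Proof.
move=> [a x] A [k [e e0 eA]].
pose M := Cinf_norm k x + 1; pose N := `|a| + 1.
have M0 : 0 < M by rewrite ltr_wpDl ?Cinf_norm_ge0.
have N0 : 0 < N by rewrite ltr_wpDl.
exists ([set b : R^o | `|a - b| < Num.min 1 (e / 2 / M)],
        [set v | Cinf_norm k (v - x) < e / 2 / N]).
  split; last by exists k, (e / 2 / N); rewrite ?divr_gt0.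
  apply/nbhs_ballP; exists (Num.min 1 (e / 2 / M)) => //=.
  by rewrite lt_min ltr01 !divr_gt0.
move=> [b v] /= []; rewrite lt_min => /andP[ab1 abM] vx; apply: eA => /=.
have -> : b *: v - a *: x = b *: (v - x) + (b - a) *: x.
  by rewrite scalerBr scalerBl addrA subrK.
rewrite (le_lt_trans (Cinf_normD _ _ _))// [e]splitr ltr_leD//.
  apply: le_lt_trans (Cinf_normZ _ _ _) _.
  have bN : `|b| <= N.
    rewrite -lerBlDl (le_trans (lerB_dist _ _))// distrC; exact: ltW.
  apply: le_lt_trans (ler_wpM2r (Cinf_norm_ge0 _ _) bN) _.
  by rewrite mulrC -ltr_pdivlMr.
apply: le_trans (Cinf_normZ _ _ _) _; rewrite distrC.
apply: (@le_trans _ _ (`|a - b| * M)); first by rewrite ler_wpM2l// lerDl.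
by rewrite -ler_pdivlMr// ltW.
Qed.

HB.instance Definition _ :=
  TopologicalNmodule_isTopologicalLmodule.Build R (Cinf R) Cinf_scale_continuous.

End CinfTopology.

(* Main.v *)
Require Import Defs.
From HB Require Import structures.
From mathcomp Require Import all_boot all_order all_algebra.
From mathcomp Require Import all_classical all_reals all_analysis.
From mathcomp Require Import ring lra.

Set Implicit Arguments.
Unset Strict Implicit.
Unset Printing Implicit Defensive.

Import Order.TTheory GRing.Theory Num.Theory.
Import numFieldTopology.Exports numFieldNormedType.Exports.

Local Open Scope classical_set_scope.
Local Open Scope ring_scope.

(** The idea is to compose a local map with a differentiable map [H] of the
    whole space that is the identity near 0 and takes all its values in a
    prescribed neighborhood [U] of 0. If [f] represents the germ and is
    differentiable on [U], then [f \o H] is defined everywhere, coincides with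
    [f] near 0, and is differentiable everywhere by the chain rule.

    The sup seminorms of the space of smooth functions are not differentiable,
    but they are dominated by Hilbertian ones: by the one-dimensional Sobolev
    inequality ([sqr_le_sobolev]), [Cinf_norm k x ^+ 2] is at most the value at
    [x] of the continuous quadratic form summing, over [j < k + 2], the squares
    of the [j]-th derivative at [- k] and of its L2 norm on [[- k, k]]
    ([Cinf_norm_sobolev]). Hence every neighborhood of 0 contains a unit ball
    [b x x < 1] of a continuous nonnegative quadratic form
    ([Cinf_hilbertian]), and
    [H x = cutoff (b x x) *: x] does the job as soon as [cutoff] is a C^1
    function of one real variable with [cutoff s = 1] near 0 and
    [cutoff s ^+ 2 * s < 1] for [0 <= s], because
    [b (H x) (H x) = cutoff (b x x) ^+ 2 * b x x].

    For the chain rule, write [H (x + t h) = H x + t k(t, h)] exactly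
    ([quotientE]); this is possible without division by [t] because
    [b (x + t h) (x + t h) - b x x] is an explicit multiple of [t] and [cutoff]
    has a slope function continuous at the base point ([cutoff_slope]). Both
    kinds of differentiability then rest on one limit, [quotient_cvg]:
    [k(t, h)] minus the derivative of [H] applied to [h] tends to 0 along any
    filter along which [t] tends to 0 and [h] is bounded in the sense that
    [e *: h] tends to 0 with the scalar [e]. That covers convergent sequences
    [h] as well as [h] ranging over a bounded set. In the latter case
    the quotients [k(t, h)] also stay in one bounded set
    ([tvs_bounded_combination]), to which the differentiability of [f] is
    applied.  *)

(** * Limits and bounded sets in topological modules *)

Section LimitsInTopologicalModules.
Context {R : realType} {X : topologicalLmodType R}.
Context {I : Type} (F : set_system I) {FF : Filter F}.

Lemma topological_cvgD (u v : I -> X) (a b : X) :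
  u @ F --> a -> v @ F --> b -> (u i + v i) @[i --> F] --> a + b.
Proof.
by move=> ua vb; apply: (cvg_comp2 ua vb); exact: (@add_continuous X (a, b)).
Qed.

Lemma topological_cvgZ (e : I -> R) (u : I -> X) (c : R) (a : X) :
  e @ F --> c -> u @ F --> a -> (e i *: u i) @[i --> F] --> c *: a.
Proof.
move=> ec ua.
by apply: (cvg_comp2 ec ua); exact: (@scale_continuous R X (c : R^o, a)).
Qed.

Lemma topological_cvg_sub0 (u v : I -> X) (a : X) :
  (u i - v i) @[i --> F] --> (0 : X) -> v @ F --> a -> u @ F --> a.
Proof.
move=> uv va; rewrite -[a]add0r; apply: cvg_trans (topological_cvgD uv va).
by under eq_fun do rewrite subrK.
Qed.

(** The common feature of convergent sequences of directions and of directions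
    taken in a bounded set, and all that the chain rule requires of them. *)
Definition asymptotically_bounded (h : I -> X) :=
  forall e : I -> R, e @ F --> (0 : R) -> (e i *: h i) @[i --> F] --> (0 : X).

Lemma cvg_asymptotically_bounded (h : I -> X) (a : X) :
  h @ F --> a -> asymptotically_bounded h.
Proof. by move=> ha e e0; rewrite -(scale0r a); exact: topological_cvgZ. Qed.

End LimitsInTopologicalModules.

Section BoundedSets.
Context {R : realType} {X : topologicalLmodType R}.
Implicit Types (S U : set X).

(** Bounded sets are those that scalars tending to 0 shrink uniformly to 0. The
    direct implication replaces balanced neighborhoods by continuity of
    scaling at [(0, 0)]: that gives [B] and [V] with [B *: V] inside [U], and
    [S] is inside a fixed multiple of [V]. *)
Lemma tvs_boundedP S : tvs_bounded S <->
  forall U, nbhs 0 U -> \forall a \near (0 : R), forall h, S h -> U (a *: h).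
Proof.
split=> [bS U U0|sS U U0].
  have : nbhs ((0 : R^o) *: (0 : X)) U by rewrite scale0r.
  move=> /(@scale_continuous R X (0 : R^o, 0))[[B V]] /= [B0 V0] BV.
  have [r [rS r0]] : exists r : R, S `<=` [set r *: u | u in V] /\ 0 < r.
    near (+oo%R : set_system R) => r; exists r; split; near: r; first exact: bS.
    exact: nbhs_pinfty_gt.
  have ar : ((a : R) * r)%R @[a --> (0 : R)] --> (0 : R).
    by rewrite -[X in _ --> X](mul0r r); apply: cvgM; [exact: cvg_id|exact: cvg_cst].
  have : \forall a \near (0 : R), B (a * r) by exact: (ar B B0).
  apply: filterS => a /= Ba h /rS[v Vv <-].
  by rewrite scalerA; exact: (BV (a * r, v)).
have /nbhs_ballP[d /= d0 dU] := sS U U0.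
near=> r => h Sh; exists (r^-1 *: h); last first.
  rewrite scalerA divff ?scale1r// gt_eqF//; near: r; exact: nbhs_pinfty_gt.
apply: dU => //=; rewrite /ball/= sub0r normrN.
have r0 : 0 < r by near: r; exact: nbhs_pinfty_gt.
rewrite gtr0_norm ?invr_gt0// invf_plt ?posrE//.
by near: r; apply: nbhs_pinfty_gt; rewrite num_real.
Unshelve. all: by end_near. Qed.

(** Uniformity over [S] is convergence along the product with the principal
    filter of [S], which makes the algebra of limits available. *)
Lemma near_uniform (F : set_system R) {FF : Filter F} S (P : R -> X -> Prop) :
  (\forall i \near filter_prod F (globally S), P i.1 i.2) <->
  \forall t \near F, forall h, S h -> P t h.
Proof.
split=> [[[A B] /= [FA SB] AB]|FP].
  by apply: filterS FA => t At h Sh; apply: (AB (t, h)); split=> //; exact: SB.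
by exists ([set t | forall h, S h -> P t h], S) => //= -[t h] /= [+ Sh]; apply.
Qed.

Lemma bounded_asymptotically_bounded I (F : set_system I) {FF : Filter F}
    (h : I -> X) S :
  tvs_bounded S -> (\forall i \near F, S (h i)) -> asymptotically_bounded F h.
Proof.
move=> /tvs_boundedP bS Sh e e0 U /bS /e0 eU.
have {}eU : \forall i \near F, forall k, S k -> U (e i *: k) by exact: eU.
by apply: filterS2 eU Sh => i; apply.
Qed.

Lemma tvs_bounded_functional S (l : X -> R) :
  scalar l -> {for 0, continuous l} -> tvs_bounded S ->
  exists2 M : R, 0 < M & forall h, S h -> `|l h| <= M.
Proof.
move=> ll cl /tvs_boundedP bS.
have l0 : l 0 = 0 by have := ll (-1) 0 0; rewrite scaler0 addr0 mulN1r addNr.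
have lZ a h : l (a *: h) = a * l h by have := ll a h 0; rewrite !addr0 l0 addr0.
have : nbhs (0 : X) [set h | `|l h| < 1].
  have cl0 : l h @[h --> (0 : X)] --> (0 : R) by rewrite -l0; exact: cl.
  exact: (@cvgr0_norm_lt _ R _ _ _ _ cl0 1 ltr01).
move=> /bS/nbhs_ballP[d /= d0 dS]; exists (2 / d) => [|h Sh].
  by rewrite divr_gt0.
have d2 : ball (0 : R) d (d / 2).
  rewrite /ball/= sub0r normrN gtr0_norm ?divr_gt0//.
  by rewrite ltr_pdivrMr// ltr_pMr// ltr1n.
have /ltW := dS (d / 2) d2 h Sh; rewrite lZ normrM gtr0_norm ?divr_gt0//.
by rewrite -ler_pdivlMl ?divr_gt0// invf_div mulr1.
Qed.

Lemma tvs_bounded_combination S (x : X) (M N : R) : tvs_bounded S ->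
  tvs_bounded [set k | exists a c h,
    [/\ `|a| <= M, `|c| <= N, S h & k = a *: h + c *: x]].
Proof.
move=> bS; apply/tvs_boundedP => U U0.
have : nbhs ((0 : X) + 0) U by rewrite addr0.
move=> /(@add_continuous X (0, 0))[[V W]] /= [V0 W0] VWU.
have /nbhs_ballP[d /= d0 dV] := (tvs_boundedP S).1 bS V V0.
have x0 : (a : R) *: x @[a --> (0 : R)] --> (0 : X).
  by rewrite -(scale0r x); apply: topological_cvgZ; [exact: cvg_id|exact: cvg_cst].
have /nbhs_ballP[g /= g0 gW] := x0 W W0.
have small (K r : R) : 0 < r -> \forall a \near (0 : R), forall b, `|b| <= K ->
    ball (0 : R) r (a * b).
  move=> r0; near=> a => b bK; rewrite /ball/= sub0r normrN normrM.
  apply: (@le_lt_trans _ _ (`|a| * (`|K| + 1))).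
    by rewrite ler_wpM2l// (le_trans bK)// (le_trans (ler_norm _))// lerDl.
  rewrite -ltr_pdivlMr ?ltr_wpDl//; near: a; apply: cvgr0_norm_lt => //.
  by rewrite divr_gt0// ltr_wpDl.
have sM := small M d d0; have sN := small N g g0.
near=> a => _ [b [c [h [bM cN Sh ->]]]]; rewrite scalerDr !scalerA.
apply: (VWU (_, _)); split => /=.
  by apply: dV => //; exact: (near sM a).
by apply: gW; exact: (near sN a).
Unshelve. all: by end_near. Qed.

End BoundedSets.

(** * A cutoff function of one real variable *)

Section Cutoff.
Variable R : realType.
Implicit Types s u v : R.

Definition ramp s : R := Num.max (4 * s - 1) 0.
(** The square of the ramp is C^1, and it grows fast enough for
    [cutoff s ^+ 2 * s] to stay below 1. *)
Definition cutoff s : R := (1 + ramp s ^+ 2)^-1.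

Lemma rampP s : [/\ 0 <= ramp s, 4 * s - 1 <= ramp s &
  ramp s = 0 \/ ramp s = 4 * s - 1].
Proof.
rewrite /ramp; case: (leP (4 * s - 1) 0) => [m0|/ltW m0]; split=> //.
  by left.
by right.
Qed.

Lemma cutoff_den_gt0 s : 0 < 1 + ramp s ^+ 2.
Proof. by rewrite ltr_pwDl// sqr_ge0. Qed.

Lemma norm_cutoff_le1 s : `|cutoff s| <= 1.
Proof.
rewrite gtr0_norm ?invr_gt0 ?cutoff_den_gt0// invf_le1 ?cutoff_den_gt0//.
by rewrite lerDl sqr_ge0.
Qed.

Lemma cutoff_near0 s : s <= 4^-1 -> cutoff s = 1.
Proof.
move=> s4; rewrite /cutoff /ramp max_r; first by rewrite expr0n addr0 invr1.
by lra.
Qed.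

Lemma cutoff_sqr_mul s : 0 <= s -> cutoff s ^+ 2 * s < 1.
Proof.
move=> s0; have d0 := cutoff_den_gt0 s; rewrite /cutoff exprVn mulrC.
rewrite ltr_pdivrMr ?exprn_gt0// mul1r.
by have [m0 ms _] := rampP s; nra.
Qed.

Lemma lipschitz_cvg (f : R -> R) v l (K : R) :
  (forall u, `|f u - l| <= K * `|u - v|) -> f u @[u --> v] --> l.
Proof.
move=> fK; apply/cvgrPdist_le => e e0.
have K0 : 0 < `|K| + 1 by rewrite ltr_wpDl.
near=> u; rewrite distrC (le_trans (fK u))//.
apply: (@le_trans _ _ ((`|K| + 1) * `|u - v|)).
  by rewrite ler_wpM2r// (le_trans (ler_norm _))// lerDl.
rewrite -ler_pdivlMl// distrC; near: u.
by apply: cvgr_dist_le; [exact: cvg_id|rewrite mulr_gt0 ?invr_gt0].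
Unshelve. all: by end_near. Qed.

(** First order Taylor expansion of [ramp ^+ 2], whose derivative
    [8 * ramp] is 32-Lipschitz. *)
Lemma sqr_ramp_taylor v u :
  `|ramp u ^+ 2 - ramp v ^+ 2 - 8 * ramp v * (u - v)| <= 16 * (u - v) ^+ 2.
Proof.
have [mu0 mu eu] := rampP u; have [mv0 mv ev] := rampP v.
have -> : u - v = ((4 * u - 1) - (4 * v - 1)) / 4 by field.
move: (4 * u - 1) (4 * v - 1) (ramp u) (ramp v) mu0 mu eu mv0 mv ev.
move=> a b x y x0 ax ex y0 bY ey; rewrite ler_norml; apply/andP.
have sa := sqr_ge0 a; have sb := sqr_ge0 b; have sab := sqr_ge0 (a - b).
case: ex ey x0 ax y0 bY => -> [] -> x0 ax y0 bY.
- by split; nra.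
- have : 0 <= b * - a by rewrite mulr_ge0// oppr_ge0.
  by split; nra.
- have : 0 <= a * - b by rewrite mulr_ge0// oppr_ge0.
  by split; nra.
- by split; nra.
Qed.

(** Differentiability of [cutoff] at [v] in Caratheodory's form, which
    composes without dividing by increments that may vanish. *)
Lemma cutoff_slope v : exists2 D : R -> R, D u @[u --> v] --> D v &
  forall u, cutoff u - cutoff v = (u - v) * D u.
Proof.
pose p u := ramp u ^+ 2.
pose g u := if u == v then 8 * ramp v else (p u - p v) / (u - v).
have gE u : p u - p v = (u - v) * g u.
  rewrite /g; case: eqVneq => [->|uv]; first by rewrite !subrr mul0r.
  by rewrite mulrC divfK// subr_eq0.
have gc : g u @[u --> v] --> g v.
  apply: (@lipschitz_cvg _ _ _ 16) => u; rewrite {2}/g eqxx.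
  have [->|uv] := eqVneq u v; first by rewrite /g eqxx !subrr normr0 mulr0.
  have uv0 : 0 < `|u - v| by rewrite normr_gt0 subr_eq0.
  rewrite -(ler_pM2r uv0) -normrM mulrBl [g u * _]mulrC -gE.
  by rewrite -[16 * _ * _]mulrA -expr2 real_normK ?num_real// sqr_ramp_taylor.
have pc : p u @[u --> v] --> p v.
  have : (u - v) * g u + p v @[u --> v] --> (v - v) * g v + p v.
    apply: cvgD; last exact: cvg_cst.
    by apply: cvgM => //; apply: cvgB; [exact: cvg_id|exact: cvg_cst].
  by rewrite -gE subrK; under eq_fun do rewrite -gE subrK.
have cc : cutoff u @[u --> v] --> cutoff v.
  apply: cvgV; first by rewrite gt_eqF ?cutoff_den_gt0.
  apply: cvgD; [exact: cvg_cst|exact: pc].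
exists (fun u => - (g u * cutoff u * cutoff v)).
  by apply: cvgN; apply: cvgM; [exact: cvgM|exact: cvg_cst].
move=> u; have du := cutoff_den_gt0 u; have dv := cutoff_den_gt0 v.
rewrite mulrN !mulrA -gE /p /cutoff; field.
by rewrite !gt_eqF.
Qed.

End Cutoff.

(** * The retraction onto a Hilbertian ball *)

Section HilbertianForms.
Context {R : realType} {X : topologicalLmodType R}.

Record hilbertian_form (b : X -> X -> R) : Prop := HilbertianForm {
  form_scalar : forall x, scalar (b x);
  form_sym : forall x y, b x y = b y x;
  form_ge0 : forall x, 0 <= b x x;
  form_continuous : continuous (fun x => b x x)
}.

Variable b : X -> X -> R.
Hypothesis hb : hilbertian_form b.

Lemma formD x h k : b x (h + k) = b x h + b x k.
Proof. by have := form_scalar hb x 1 h k; rewrite scale1r mul1r. Qed.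

Lemma form0 x : b x 0 = 0.
Proof. by apply: (addIr (b x 0)); rewrite -formD !add0r. Qed.

Lemma formZ x a h : b x (a *: h) = a * b x h.
Proof. by have := form_scalar hb x a h 0; rewrite form0 !addr0. Qed.

Lemma form_sqrZ a h : b (a *: h) (a *: h) = a ^+ 2 * b h h.
Proof. by rewrite formZ (form_sym hb) formZ mulrA expr2. Qed.

Lemma form_sqrD x t h : b (x + t *: h) (x + t *: h) =
  b x x + t * (2 * b x h + t * b h h).
Proof.
rewrite formD ![b (x + _) _](form_sym hb) !formD (form_sym hb (t *: h) x).
by rewrite form_sqrZ !formZ; ring.
Qed.

(** Polarization recovers [b x] from the quadratic form. *)
Lemma form_continuousr x : continuous (b x).
Proof.
have polar h : b x h = (b (x + h) (x + h) - b x x - b h h) / 2.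
  by have := form_sqrD x 1 h; rewrite scale1r => ->; field.
move=> h; rewrite /continuous_at (funext polar) polar.
apply: cvgM; last exact: cvg_cst.
apply: cvgB; last exact: (form_continuous hb).
apply: cvgB; last exact: cvg_cst.
apply: (@cvg_comp _ _ _ (fun h => x + h) (fun z => b z z)); last first.
  exact: (form_continuous hb).
by apply: topological_cvgD; [exact: cvg_cst|exact: cvg_id].
Qed.

(** A retraction only in the sense of being the identity near 0 with values in
    the unit ball of [b]. *)
Definition retract x : X := cutoff (b x x) *: x.

Lemma retract_near0 : \forall x \near (0 : X), retract x = x.
Proof.
have : b x x @[x --> (0 : X)] --> (0 : R).
  by rewrite -[X in _ --> X](form0 0); exact: (form_continuous hb).
move=> /(@cvgr0_norm_le _ R _ _ _ _) /(_ 4^-1).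
rewrite invr_gt0 ltr0n => /(_ isT); apply: filterS => x xle.
by rewrite /retract cutoff_near0 ?scale1r// (le_trans (ler_norm _)).
Qed.

Lemma form_retract_lt1 x : b (retract x) (retract x) < 1.
Proof. by rewrite form_sqrZ cutoff_sqr_mul// (form_ge0 hb). Qed.

Section DifferenceQuotient.
Variables (x : X) (D : R -> R).
Hypothesis Dcvg : D u @[u --> b x x] --> D (b x x).
Hypothesis Dslope : forall u, cutoff u - cutoff (b x x) = (u - b x x) * D u.

Definition quotient_coef t h : R :=
  D (b (x + t *: h) (x + t *: h)) * (2 * b x h + t * b h h).

(** The difference quotient of [retract] at [x] in the direction [h], in a form
    that still makes sense when [t = 0] and then equals [retract_deriv h]. *)
Definition quotient t h : X :=
  cutoff (b (x + t *: h) (x + t *: h)) *: h + quotient_coef t h *: x.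

Definition retract_deriv h : X :=
  cutoff (b x x) *: h + (D (b x x) * (2 * b x h)) *: x.

Lemma quotientE t h : retract (x + t *: h) = retract x + t *: quotient t h.
Proof.
rewrite /retract /quotient /quotient_coef !scalerDr.
rewrite [t *: (cutoff _ *: h)]scalerA [cutoff _ *: (t *: h)]scalerA.
rewrite [t * cutoff _]mulrC [LHS]addrC [RHS]addrCA; congr (_ + _).
rewrite scalerA -scalerDl; congr (_ *: _).
rewrite -[LHS](subrK (cutoff (b x x))) Dslope addrC; congr (_ + _).
by rewrite form_sqrD; ring.
Qed.

Lemma retract_deriv_linear : linear retract_deriv.
Proof.
move=> a h k; rewrite /retract_deriv (form_scalar hb) [_ *: (_ + _)]scalerDr.
rewrite mulrDr mulrDr scalerDl [in RHS]scalerDr addrACA; congr (_ + _ + (_ + _)).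
- by rewrite !scalerA mulrC.
- by rewrite scalerA; congr (_ *: _); rewrite /=; ring.
Qed.

Lemma retract_deriv_continuous : continuous retract_deriv.
Proof.
move=> h; apply: topological_cvgD.
  by apply: topological_cvgZ; [exact: cvg_cst|exact: cvg_id].
apply: topological_cvgZ; last exact: cvg_cst.
do 2 (apply: cvgM; first exact: cvg_cst); exact: form_continuousr.
Qed.

Section QuotientLimit.
Context {I : Type} (F : set_system I) {FF : Filter F}.
Variables (t : I -> R) (h : I -> X).
Hypothesis t0 : t @ F --> (0 : R).
Hypothesis hbounded : asymptotically_bounded F h.

Let q i := b (x + t i *: h i) (x + t i *: h i).

Let q_cvg : q @ F --> b x x.
Proof.
have xt : x + t i *: h i @[i --> F] --> x.
  rewrite -[X in _ --> X]addr0; apply: topological_cvgD; last exact: hbounded.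
  exact: cvg_cst.
apply: (@cvg_comp _ _ _ _ (fun z => b z z) F (nbhs x) _ xt).
exact: (form_continuous hb).
Qed.

Let D_cvg : D (q i) @[i --> F] --> D (b x x).
Proof. exact: (@cvg_comp _ _ _ q D F (nbhs (b x x)) _ q_cvg Dcvg). Qed.

Let form_cvg0 e : e @ F --> (0 : R) -> e i * b x (h i) @[i --> F] --> (0 : R).
Proof.
move=> /hbounded eh; under eq_fun do rewrite -formZ.
rewrite -(form0 x).
by apply: (@cvg_comp _ _ _ _ (b x) F (nbhs (0 : X)) _ eh); exact: form_continuousr.
Qed.

(* Up to sign, [t * b h h] is the quadratic form at [Num.sqrt `|t| *: h]. *)
Let sqr_form_cvg0 : t i * b (h i) (h i) @[i --> F] --> (0 : R).
Proof.
apply/cvgr0Pnorm_lt => e e0.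
have s0 : Num.sqrt `|t i| @[i --> F] --> (0 : R).
  rewrite -(sqrtr0 R) -(normr0 R).
  apply: (@cvg_comp _ _ _ (fun i => `|t i|) Num.sqrt); last exact: sqrt_continuous.
  exact: cvg_norm.
have : b (Num.sqrt `|t i| *: h i) (Num.sqrt `|t i| *: h i) @[i --> F] --> (0 : R).
  rewrite -(form0 0).
  apply: (@cvg_comp _ _ _ _ (fun z => b z z) F (nbhs (0 : X)) _ (hbounded s0)).
  exact: (form_continuous hb).
move=> /(@cvgr0_norm_lt _ R _ _ _ _) /(_ e e0); apply: filterS => i.
by rewrite form_sqrZ sqr_sqrtr// !normrM normr_id.
Qed.

Lemma quotient_coef_cvg :
  quotient_coef (t i) (h i) - D (b x x) * (2 * b x (h i)) @[i --> F] --> (0 : R).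
Proof.
have : 2 * ((D (q i) - D (b x x)) * b x (h i)) +
    D (q i) * (t i * b (h i) (h i)) @[i --> F] --> 2 * 0 + D (b x x) * 0.
  apply: cvgD; last exact: cvgM.
  apply: cvgM; first exact: cvg_cst.
  apply: form_cvg0; rewrite -(subrr (D (b x x))).
  by apply: cvgB => //; exact: cvg_cst.
rewrite !mulr0 addr0 => lim; apply: cvg_trans lim.
rewrite (_ : (fun i => quotient_coef _ _ - _) = (fun i =>
  2 * ((D (q i) - D (b x x)) * b x (h i)) + D (q i) * (t i * b (h i) (h i))))//.
by apply/funext => i; rewrite /quotient_coef -/(q i); ring.
Qed.

(** The error is [e *: h + c *: x], where [e] is the increment of the cutoff and
    [c] the error on the coefficient; both scalars tend to 0, and [e *: h] does
    too because [h] is asymptotically bounded. *)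
Lemma quotient_cvg :
  quotient (t i) (h i) - retract_deriv (h i) @[i --> F] --> (0 : X).
Proof.
have e0 : cutoff (q i) - cutoff (b x x) @[i --> F] --> (0 : R).
  under eq_fun do rewrite Dslope.
  rewrite -(mul0r (D (b x x))) -(subrr (b x x)).
  by apply: cvgM => //; apply: cvgB => //; exact: cvg_cst.
rewrite (_ : (fun i => quotient _ _ - _) = (fun i =>
  (cutoff (q i) - cutoff (b x x)) *: h i +
  (quotient_coef (t i) (h i) - D (b x x) * (2 * b x (h i))) *: x)); last first.
  by apply/funext => i; rewrite !scalerBl addrACA -opprD.
rewrite -[X in _ --> X]addr0; apply: topological_cvgD; first exact: hbounded.
rewrite -[X in _ --> X](scale0r x); apply: topological_cvgZ.
  exact: quotient_coef_cvg.
exact: cvg_cst.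
Qed.

End QuotientLimit.
End DifferenceQuotient.
End HilbertianForms.

(** * Extension of germs by composition with the retraction *)

Section Extension.
Context {R : realType} {X Y : topologicalLmodType R}.

Lemma linear_pack (f : X -> Y) : linear f -> exists A : {linear X -> Y}, A =1 f.
Proof.
move=> lf; pose m := GRing.isLinear.Build R X Y *:%R f lf.
by pose A : {linear X -> Y} := HB.pack f m; exists A.
Qed.

Lemma linear_continuous_comp (A : {linear X -> Y}) (L : X -> X) :
  continuous A -> linear L -> continuous L ->
  exists2 B : {linear X -> Y}, continuous B & forall h, B h = A (L h).
Proof.
move=> cA lL cL; have lAL : linear (A \o L) by move=> a h k; rewrite /= lL linearP.
have [B BE] := linear_pack lAL; exists B => // h.
rewrite (funext BE); apply: continuous_comp; [exact: cL|exact: cA].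
Qed.

Variable b : X -> X -> R.
Hypothesis hb : hilbertian_form b.

Definition extension (f : Defs.pmap X Y) : Defs.pmap X Y := PMap setT (f \o retract b).

(** The quotients along [t n], [h_ n] form a convergent sequence of directions
    to which the hypothesis on [f] applies. *)
Lemma extension_compact_differentiable f x :
  compact_differentiable_at f (retract b x) ->
  compact_differentiable_at (extension f) x.
Proof.
move=> [_ [A [cA fA]]]; split; first exact: filterT.
have [D Dcvg Dslope] := cutoff_slope (b x x).
have [B cB BE] := linear_continuous_comp cA (retract_deriv_linear hb x D)
  (retract_deriv_continuous hb (x := x) (D := D)).
exists B; split=> // t h_ h t0 hh.
have kL : quotient b x D (t n) (h_ n) @[n --> \oo] --> retract_deriv b x D h.
  apply: topological_cvg_sub0.
    exact: (quotient_cvg hb Dcvg Dslope t0 (cvg_asymptotically_bounded hh)).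
  apply: (@cvg_comp _ _ _ h_ (retract_deriv b x D) _ (nbhs h) _ hh).
  exact: retract_deriv_continuous.
have := fA _ _ _ t0 kL; apply: cvg_trans.
by under eq_fun do rewrite /= (quotientE hb Dslope) BE.
Qed.

(** With [k] the quotient and [L] the derivative of [retract], the remainder of
    the composite divided by [t] is that of [f] in the direction [k t h], plus
    [A (k t h - L h)]. The first term is small because the [k t h] lie in one
    bounded set, the second by [quotient_cvg]. *)
Lemma extension_bounded_differentiable f x :
  bounded_differentiable_at f (retract b x) ->
  bounded_differentiable_at (extension f) x.
Proof.
move=> [_ [A [cA fA]]]; split; first exact: filterT.
have [D Dcvg Dslope] := cutoff_slope (b x x).
have [B cB BE] := linear_continuous_comp cA (retract_deriv_linear hb x D)
  (retract_deriv_continuous hb (x := x) (D := D)).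
exists B; split=> // r S bS W W0.
pose k := quotient b x D; pose L := retract_deriv b x D.
have rE t h : t != 0 -> t^-1 *: r (t *: h) =
    t^-1 *: (f (retract b x + t *: k t h) - f (retract b x) - A (t *: k t h)) +
    A (k t h - L h).
  move=> t0; rewrite /r /= (quotientE hb Dslope) [B _]linearZ /= BE -/k -/L.
  move: (k t h) (L h) => kth Lh.
  rewrite [A (kth - Lh)]linearB [A (t *: _)]linearZ /=.
  rewrite !(scalerDr, scalerN) !scalerA mulVf// !scale1r.
  by rewrite addrA subrK.
have : nbhs ((0 : Y) + 0) W by rewrite addr0.
move=> /(@add_continuous Y (0, 0))[[V1 V2]] /= [V10 V20] VW.
pose F := filter_prod (0 : R)^' (globally S).
have FF : Filter F by exact: filter_prod_filter.
have t0 : fst @ F --> (0 : R).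
  by move=> P /nbhs_dnbhs; exact: (@filter_prod1 _ _ (0 : R)^' (globally S) _ P).
have SF : \forall i \near F, S i.2 by exact: (@filter_prod2 _ _ (0 : R)^' (globally S) _ S).
have hF : asymptotically_bounded F snd.
  exact: bounded_asymptotically_bounded bS SF.
have kL : A (k i.1 i.2 - L i.2) @[i --> F] --> (0 : Y).
  rewrite -(linear0 A); apply: (@cvg_comp _ _ _ (fun i => k i.1 i.2 - L i.2) A
    F (nbhs (0 : X))); last exact: cA.
  exact: (quotient_cvg hb Dcvg Dslope t0 hF).
have [M M0 bM] := tvs_bounded_functional (form_scalar hb x)
  (form_continuousr hb (x := x) (x0 := 0)) bS.
(* The coefficient of [x] in [k t h] differs from its limit, at most
   [`|D (b x x)| * (2 * M)] in absolute value, by at most 1 for small [t]. *)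
pose N := `|D (b x x)| * (2 * M) + 1.
have coefN : \forall i \near F, `|quotient_coef b x D i.1 i.2| <= N.
  have cF : \forall i \near F,
      `|quotient_coef b x D i.1 i.2 - D (b x x) * (2 * b x i.2)| <= 1.
    apply: (@cvgr0_norm_le _ R _ F _ _ _ 1 ltr01).
    exact: (quotient_coef_cvg hb Dcvg t0 hF).
  apply: filterS2 SF cF => i Si ci; rewrite -[X in `|X|](subrK (D (b x x) * (2 * b x i.2))).
  rewrite (le_trans (ler_normD _ _))// addrC lerD// normrM ler_wpM2l// normrM.
  by rewrite ger0_norm// ler_wpM2l// bM.
have V1F := fA _ (tvs_bounded_combination x 1 N bS) V1 V10.
pose V1P t := forall k, [set k | exists a c h,
    [/\ `|a| <= 1, `|c| <= N, S h & k = a *: h + c *: x]] k ->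
    V1 (t^-1 *: (f (retract b x + t *: k) - f (retract b x) - A (t *: k))).
have V1F' : \forall i \near F, V1P i.1.
  exact: (@filter_prod1 _ _ (0 : R)^' (globally S) _ V1P V1F).
have n0 : \forall i \near F, i.1 != 0.
  apply: (@filter_prod1 _ _ (0 : R)^' (globally S) _ (fun t => t != 0)).
  exact: nbhs_dnbhs_neq.
apply/near_uniform; near=> i; rewrite rE; last by near: i.
apply: (VW (_, _)); split=> /=; last by near: i; exact: kL.
apply: (near V1F' i) => //.
exists (cutoff (b (x + i.1 *: i.2) (x + i.1 *: i.2))).
exists (quotient_coef b x D i.1 i.2), i.2.
split=> //; [|by near: i|by near: i].
exact: norm_cutoff_le1.
Unshelve. all: by end_near. Qed.

End Extension.

Definition hilbertian_topology (R : realType) (X : topologicalLmodType R) :=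
  forall U : set X, nbhs 0 U -> exists2 b : X -> X -> R, hilbertian_form b &
    forall x, b x x < 1 -> U x.

(** Only the germ at 0 of the chosen representative matters: it is
    differentiable on a neighborhood, and [retract] maps everything there. *)
Lemma germ_extension (R : realType) (X Y : topologicalLmodType R)
    (diff_at : Defs.pmap X Y -> X -> Prop) :
  hilbertian_topology X ->
  (forall b, hilbertian_form b -> forall f x,
    diff_at f (retract b x) -> diff_at (extension b f) x) ->
  forall G : germ X Y,
    differentiable_germ diff_at G -> has_global_representative diff_at G.
Proof.
move=> hX ext G [f Gf [U U0 fU]]; have [b hb bU] := hX U U0.
exists (extension b f); last first.
  by split=> // x; apply: (ext b hb); apply: fU; apply: bU; exact: form_retract_lt1.
have [g g0 GE] := germ_class G; move: Gf; rewrite GE => -[_ [V V0 [Vfg gf]]].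
split; first exact: filterT.
exists (V `&` [set x | retract b x = x]).
  by apply: filterI => //; exact: retract_near0.
split=> [x [/Vfg[gx _] _]|x [/gf -> /= ->]] //.
Qed.

(** * Sobolev forms on smooth functions *)

Section SobolevForms.
Variable R : realType.
Local Notation mu := (@lebesgue_measure R).

Lemma continuous_itv_integrable (f : R -> R) (a b : R) :
  continuous f -> mu.-integrable `[a, b] (EFin \o f).
Proof.
move=> cf; apply: continuous_compact_integrable; first exact: segment_compact.
exact: continuous_subspaceT.
Qed.

(** The increment of [g ^+ 2] from [a] to [t] is the integral of [2 g g'],
    which is at most that of [g ^+ 2 + g' ^+ 2]. *)
Lemma sqr_le_sobolev (g g' : R -> R) (a b t : R) :
  (forall s : R, is_derive s 1 g (g' s)) -> continuous g' -> a <= t <= b ->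
  g t ^+ 2 <= g a ^+ 2 + \int[mu]_(s in `[a, b]) (g s * g s)
    + \int[mu]_(s in `[a, b]) (g' s * g' s).
Proof.
move=> dg cg' /andP[at_ tb].
have cg : continuous g.
  by move=> s; apply: differentiable_continuous; apply/derivable1_diffP.
have cgg : continuous (fun s => g s * g s) by move=> s; apply: cvgM; exact: cg.
have cgg' : continuous (fun s => g' s * g' s).
  by move=> s; apply: cvgM; exact: cg'.
have cd : continuous (fun s => 2 * g s * g' s).
  by move=> s; apply: cvgM; [apply: cvgM; [exact: cvg_cst|exact: cg]|exact: cg'].
rewrite -addrA -lerBlDl -RintegralD//; try exact: continuous_itv_integrable.
have cs : continuous (fun s => g s * g s + g' s * g' s).
  by move=> s; apply: cvgD; [exact: cgg|exact: cgg'].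
have pos s : 0 <= g s * g s + g' s * g' s by rewrite addr_ge0// -expr2 sqr_ge0.
have [<-|neq] := eqVneq a t; first by rewrite subrr Rintegral_ge0.
have {neq}at_ : a < t by rewrite lt_neqAle neq.
have dgg (s : R) : is_derive s 1 (fun s : R => g s ^+ 2 : R) (2 * g s * g' s).
  by apply: is_derive_eq; rewrite /GRing.scale/=; ring.
have FTC : g t ^+ 2 - g a ^+ 2 = \int[mu]_(s in `[a, t]) (2 * g s * g' s).
  rewrite /Rintegral (@continuous_FTC2 _ _ (fun s => g s ^+ 2) _ _ at_)//.
  - exact: continuous_subspaceT.
  - split=> [s _||]; first exact: ex_derive.
    + apply: cvg_at_right_filter; exact: cgg.
    + apply: cvg_at_left_filter; exact: cgg.
  - by move=> s _; rewrite derive1E; apply: derive_val.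
rewrite FTC; apply: (@le_trans _ _ (\int[mu]_(s in `[a, t]) (g s * g s + g' s * g' s))).
  apply: le_Rintegral => //; try exact: continuous_itv_integrable.
  by move=> s _; have := sqr_ge0 (g s - g' s); nra.
have {}at_ := ltW at_; rewrite -subr_ge0 Rintegral_itvB ?bnd_simp//.
  by apply: Rintegral_ge0 => s _; exact: pos.
exact: continuous_itv_integrable.
Qed.

Section Form.
Variable k : nat.
Let I : set R := `[- k%:R, k%:R].

Definition sobolev_term j (x y : Cinf R) : R :=
  derive1n j x (- k%:R) * derive1n j y (- k%:R) +
  \int[mu]_(t in I) (derive1n j x t * derive1n j y t).

(** One derivative more than [Cinf_norm k] sees, since bounding a derivative
    uniformly takes the L2 norm of the next one. *)
Definition sobolev x y := \sum_(j < k.+2) sobolev_term j x y.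

Lemma derive1n_continuous j (x : Cinf R) : continuous (derive1n j x).
Proof.
move=> t; apply: differentiable_continuous; apply/derivable1_diffP.
exact: CinfP.
Qed.

Lemma derive1n_mul_continuous i j (x y : Cinf R) :
  continuous (fun t : R => derive1n i x t * derive1n j y t : R).
Proof. by move=> t; apply: cvgM; exact: derive1n_continuous. Qed.

Let mI : measurable I. Proof. exact: measurable_itv. Qed.

Let prod_integrable j (x y : Cinf R) :
  mu.-integrable I (EFin \o (fun t : R => derive1n j x t * derive1n j y t : R)).
Proof. by apply: continuous_itv_integrable; exact: derive1n_mul_continuous. Qed.

Lemma sobolev_term_scalar j x : scalar (sobolev_term j x).
Proof.
move=> c y z; rewrite /sobolev_term /= !derive1n_Cinf_lin.
under eq_Rintegral do rewrite derive1n_Cinf_lin mulrDr mulrCA.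
rewrite RintegralD//; last first.
  apply: continuous_itv_integrable => t; apply: cvgM; first exact: cvg_cst.
  exact: derive1n_mul_continuous.
by rewrite RintegralZl//; ring.
Qed.

Lemma sobolev_term_ge0 j x : 0 <= sobolev_term j x x.
Proof.
rewrite /sobolev_term addr_ge0//; first by rewrite -expr2 sqr_ge0.
by apply: Rintegral_ge0 => t _; rewrite -expr2 sqr_ge0.
Qed.

Definition sobolev_const : R := k.+2%:R * (1 + fine (mu I)).

Lemma sobolev_bound x y :
  `|sobolev x y| <= sobolev_const * (Cinf_norm k.+1 x * Cinf_norm k.+1 y).
Proof.
set NN := Cinf_norm _ _ * _.
have NN0 : 0 <= NN by rewrite mulr_ge0 ?Cinf_norm_ge0.
have prodN (j : 'I_k.+2) t : I t -> `|derive1n j x t * derive1n j y t| <= NN.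
  rewrite /I /= in_itv /= -ler_norml => tk; rewrite normrM.
  have tk1 : `|t| <= k.+1%:R by rewrite (le_trans tk)// ler_nat.
  by rewrite ler_pM// Cinf_norm_ge// -ltnS.
have Ik : I (- k%:R).
  by rewrite /I/= in_itv/= lexx/= (le_trans _ (ler0n _ k))// oppr_le0.
rewrite (le_trans (ler_norm_sum _ _ _))// /sobolev_const -mulrA.
apply: (@le_trans _ _ (\sum_(j < k.+2) (1 + fine (mu I)) * NN)); last first.
  by rewrite sumr_const card_ord mulr_natl.
apply: ler_sum => j _; rewrite (le_trans (ler_normD _ _))// mulrDl mul1r lerD//.
  exact: prodN.
apply: le_trans (le_normr_Rintegral _ _) _ => //.
rewrite mulrC -Rintegral_cst//.
apply: le_Rintegral => //.
- apply: continuous_itv_integrable => t; apply: cvg_norm.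
  exact: derive1n_mul_continuous.
- apply: continuous_itv_integrable => t; exact: cvg_cst.
- by move=> t It; exact: prodN.
Qed.

Lemma sobolev_scalar x : scalar (sobolev x).
Proof.
move=> c y z; rewrite /sobolev mulr_sumr -big_split; apply: eq_bigr => j _.
exact: sobolev_term_scalar.
Qed.

Lemma sobolev_sym x y : sobolev x y = sobolev y x.
Proof.
apply: eq_bigr => j _; rewrite /sobolev_term mulrC; congr (_ + _).
by under eq_Rintegral do rewrite mulrC.
Qed.

(** [sqr_le_sobolev] applied to the [j]-th derivative involves only the terms of
    index [j] and [j + 1] of the Sobolev form. *)
Lemma Cinf_norm_sobolev x : Cinf_norm k x ^+ 2 <= sobolev x x.
Proof.
have S0 : 0 <= sobolev x x by apply: sumr_ge0 => j _; exact: sobolev_term_ge0.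
rewrite -[leRHS]sqr_sqrtr// ler_sqr ?nnegrE ?Cinf_norm_ge0 ?sqrtr_ge0//.
apply/Cinf_norm_le; split=> [|j t jk]; first exact: sqrtr_ge0.
rewrite ler_norml => tk; rewrite -sqrtr_sqr ler_wsqrtr//.
have := @sqr_le_sobolev (derive1n j x) (derive1n j.+1 x) (- k%:R) k%:R t _ _ tk.
move=> /(_ _ _)/le_trans; apply.
- move=> s; rewrite derive1nS derive1E; apply: derivableP; exact: CinfP.
- exact: derive1n_continuous.
have j2 : (j < k.+2)%N by rewrite ltnS leqW.
have j1 : (j.+1 < k.+2)%N by rewrite !ltnS.
rewrite /sobolev (bigD1 (Ordinal j2))//= (bigD1 (Ordinal j1))/=; last first.
  by rewrite -val_eqE /= gtn_eqF.
rewrite addrA -[leLHS]addr0 lerD//; last first.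
  by apply: sumr_ge0 => i _; exact: sobolev_term_ge0.
by rewrite {1}/sobolev_term -expr2 lerD// /sobolev_term lerDr -expr2 sqr_ge0.
Qed.

End Form.
End SobolevForms.

(** * Smooth functions have a Hilbertian topology *)

Section CinfHilbertian.
Variable R : realType.

Lemma Cinf_norm_cvg0 k (x : Cinf R) :
  Cinf_norm k (y - x) @[y --> x] --> (0 : R).
Proof.
have FF : Filter (Cinf_nbhs x) := nbhs_filter x.
apply/cvgr0Pnorm_lt => e e0; exists k, e => // y /=.
by rewrite ger0_norm// Cinf_norm_ge0.
Qed.

(** Continuity of the quadratic form follows from [sobolev_bound]: with
    [n = N (y - x)], it varies by at most [C * n * (2 * N x + n)]. *)
Lemma sobolev_form k : hilbertian_form (@sobolev R k).
Proof.
split; [exact: sobolev_scalar|exact: sobolev_sym| |] => x.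
  by apply: sumr_ge0 => j _; exact: sobolev_term_ge0.
have FF : Filter (Cinf_nbhs x) := nbhs_filter x.
pose N := @Cinf_norm R k.+1; pose C := sobolev_const R k.
have N0 : N (y - x) @[y --> x] --> (0 : R) by exact: Cinf_norm_cvg0.
have CN0 : C * N (y - x) * (2 * N x + N (y - x)) @[y --> x] --> (0 : R).
  have -> : 0 = C * 0 * (2 * N x + 0) by rewrite mulr0 mul0r.
  by apply: cvgM; [apply: cvgM => //|apply: cvgD => //]; exact: cvg_cst.
apply/cvgrPdist_lt => e e0.
have small : \forall y \near x, `|C * N (y - x) * (2 * N x + N (y - x))| < e.
  exact: (@cvgr0_norm_lt _ R _ _ _ _ CN0 e e0).
apply: filterS small => y; apply: le_lt_trans.
apply: le_trans (ler_norm _).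
have qE : sobolev k y y =
    sobolev k x x + 2 * sobolev k x (y - x) + sobolev k (y - x) (y - x).
  have yE : y = x + (y - x) by rewrite addrC subrK.
  have D u v w : sobolev k u (v + w) = sobolev k u v + sobolev k u w.
    by have := sobolev_scalar k u 1 v w; rewrite scale1r mul1r.
  move: (y - x) yE => h ->; rewrite D ![sobolev k (x + h) _]sobolev_sym !D.
  by rewrite (sobolev_sym k h x); ring.
have -> : sobolev k x x - sobolev k y y =
    - (2 * sobolev k x (y - x) + sobolev k (y - x) (y - x)) by rewrite qE; ring.
rewrite normrN (le_trans (ler_normD _ _))// normrM ger0_norm//.
have B1 := sobolev_bound k x (y - x).
have B2 := sobolev_bound k (y - x) (y - x).
have -> : C * N (y - x) * (2 * N x + N (y - x)) =
    2 * (C * (N x * N (y - x))) + C * (N (y - x) * N (y - x)) by ring.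
by rewrite lerD// ler_wpM2l.
Qed.

Lemma hilbertian_formZ (X : topologicalLmodType R) (b : X -> X -> R) (c : R) :
  0 <= c -> hilbertian_form b -> hilbertian_form (fun x y => c * b x y).
Proof.
move=> c0 [bl bs bp bc]; split=> [x a y z|x y|x|x].
- by rewrite /= bl; ring.
- by rewrite bs.
- by rewrite mulr_ge0.
- by apply: cvgM; [exact: cvg_cst|exact: bc].
Qed.

Lemma Cinf_hilbertian : hilbertian_topology (Cinf R).
Proof.
move=> U [k [e e0 eU]]; exists (fun x y => (e ^+ 2)^-1 * sobolev k x y).
  by apply: hilbertian_formZ (sobolev_form k); rewrite invr_ge0 sqr_ge0.
move=> x; rewrite mulrC ltr_pdivrMr ?exprn_gt0// mul1r => xe.
apply: eU; rewrite /= subr0 -(@ltr_pXn2r _ 2)// ?nnegrE ?Cinf_norm_ge0 ?ltW//.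
exact: le_lt_trans (Cinf_norm_sobolev k x) xe.
Qed.

End CinfHilbertian.

(** * Global representatives *)

Theorem corollary5p7 (R : realType) (Y : topologicalLmodType R) :
  (forall G : germ (Cinf R) Y,
     differentiable_germ bounded_differentiable_at G ->
     has_global_representative bounded_differentiable_at G) /\
  (forall G : germ (Cinf R) Y,
     differentiable_germ compact_differentiable_at G ->
     has_global_representative compact_differentiable_at G).
Proof.
have hC := @Cinf_hilbertian R.
split; apply: germ_extension => // b hb f x.
  exact: extension_bounded_differentiable.
exact: extension_compact_differentiable.
Qed.
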